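(* Let $B$ be a unital $\mathbb K$-algebra. The following binary operations are post-Lie products over the Lie algebra $(\mathfrak g_B^{\mathrm{inv}},[-,-])$, where $[f,g]=f\cdot g-g\cdot f$: $$f\blacktriangleright_l g:=\{g,If\},\qquad f\blacktriangleright_r g:=\{g,-fI\}=-\{g,fI\}.$$ Combining these, the operation $$f\blacktriangleright g:=\{g,[I,f]\}$$ is also a post-Lie product over $(\mathfrak g_B^{\mathrm{inv}},[-,-])$.
   Context: $\mathbb K$ is a field of characteristic zero. For a unital $\mathbb K$-algebra $B$, $\mathrm{Mult}[[B]]$ is the $\mathbb K$-vector space of sequences $f=(f_n)_{n\ge0}$ of $\mathbb K$-multilinear maps $f_n:B^{\otimes n}\to B$ (with $B^{\otimes 0}=\mathbb K$, so $f_0$ is identified with an element of $B$), with product $(f\cdot g)_n(x_1,\dots,x_n)=\sum_{k=0}^n f_k(x_1,\dots,x_k)\,g_{n-k}(x_{k+1},\dots,x_n)$, also written $fg$. $I:=(\delta_{n,1}\mathrm{Id})_{n\ge0}$, and $\mathfrak g_B^{\mathrm{inv}}:=\{f\in\mathrm{Mult}[[B]]: f_0=0\}$. For $f,g\in\mathfrak g_B^{\mathrm{inv}}$, $\{f,g\}\in\mathfrak g_B^{\mathrm{inv}}$ is the series with, for $N\ge1$, $$\{f,g\}_N(x_1,\dots,x_N)=\sum_{\substack{n,m\ge1\\ n+m=N+1}}\ \sum_{i=1}^n f_n\big(x_1,\dots,x_{i-1},g_m(x_i,\dots,x_{i+m-1}),x_{i+m},\dots,x_N\big).$$ A bilinear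 product $\blacktriangleright$ on a Lie algebra $(\mathfrak g,[\cdot,\cdot])$ is a post-Lie product (and $(\mathfrak g,[\cdot,\cdot],\blacktriangleright)$ is a post-Lie algebra) if for all $x,y,z\in\mathfrak g$: $z\blacktriangleright[x,y]=[z\blacktriangleright x,y]+[x,z\blacktriangleright y]$ and $[x,y]\blacktriangleright z=\mathrm a_\blacktriangleright(x,y,z)-\mathrm a_\blacktriangleright(y,x,z)$, where $\mathrm a_\blacktriangleright(x,y,z)=x\blacktriangleright(y\blacktriangleright z)-(x\blacktriangleright y)\blacktriangleright z$. *)

(* Defs.v *)
From HB Require Import structures.
From mathcomp Require Import all_boot all_order all_algebra.
From mathcomp Require Import all_classical.

Set Implicit Arguments.
Unset Strict Implicit.
Unset Printing Implicit Defensive.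

Import GRing.Theory.
Local Open Scope ring_scope.

Section PostLie.
Variables (K : fieldType) (g : lmodType K).
Implicit Types br tr : g -> g -> g.

Definition bilinear_op tr :=
  (forall x, linear (tr x)) /\ (forall y, linear (tr^~ y)).

Definition lie_bracket br :=
  [/\ bilinear_op br,
      forall x, br x x = 0
    & forall x y z, br x (br y z) + br y (br z x) + br z (br x y) = 0].

Definition assoc_of tr x y z := tr x (tr y z) - tr (tr x y) z.

Definition post_lie_product br tr :=
  [/\ lie_bracket br,
      bilinear_op tr,
      forall x y z, tr z (br x y) = br (tr z x) y + br x (tr z y)
    & forall x y z, tr (br x y) z = assoc_of tr x y z - assoc_of tr y x z].

End PostLie.

(* Since [seq B] is the disjoint union of the powers B^n, a family of maps    *)
(* f_n : B^n -> B (n >= 0) is the same thing as a single map f : seq B -> B:  *)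
(* f_n is the restriction of f to the sequences of size n, and f_0 is         *)
(* identified with the element f [::] of B.                                   *)
Section MultDef.
Variables (K : fieldType) (B : algType K).
Implicit Types (f g : seq B -> B) (s : seq B).

(* Every f_n is K-linear in each of its n arguments.                          *)
Definition multilinear f :=
  forall s1 s2, linear (fun x : B => f (s1 ++ x :: s2)).

Definition multilinear_pred : {pred (seq B -> B)} :=
  fun f => `[< multilinear f >].

Lemma multilinear_submod_closed : submod_closed multilinear_pred.
Proof.
split=> [|a f g /asboolP fL /asboolP gL]; apply/asboolP => s1 s2 c u v.
  by rewrite scaler0 addr0.
transitivity (a *: f (s1 ++ (c *: u + v) :: s2) + g (s1 ++ (c *: u + v) :: s2)).
  by [].
rewrite fL gL scalerDr scalerA mulrC -scalerA addrACA -scalerDr.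
by [].
Qed.

HB.instance Definition _ := GRing.isSubmodClosed.Build K (seq B -> B)
  multilinear_pred (GRing.submod_closed_semi multilinear_submod_closed).

Record mult := Mult {
  mult_fun :> seq B -> B;
  mult_funP : mult_fun \in multilinear_pred }.

HB.instance Definition _ := [isSub for mult_fun].
HB.instance Definition _ := [Choice of mult by <:].
HB.instance Definition _ := [SubChoice_isSubLmodule of mult by <:].

End MultDef.
Arguments mult {K} B.

Section Operations.
Variables (K : fieldType) (B : algType K).
Implicit Types (f g : mult B) (s : seq B).

Lemma multP f s1 s2 : linear (fun x : B => f (s1 ++ x :: s2)).
Proof. by case: f => f /= /asboolP. Qed.

Definition mult_mul_fun f g s : B :=
  \sum_(k < (size s).+1) f (take k s) * g (drop k s).

Definition mult_I_fun s : B := if s is [:: x] then x else 0.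

(* Here [i] runs over 0, ..., n - 1: it is the number of arguments preceding  *)
(* the inner block.                                                           *)
Definition mult_ins_fun f g s : B :=
  \sum_(1 <= n < (size s).+1)
    \sum_(1 <= m < (size s).+1 | (n + m == (size s).+1)%N)
      \sum_(i < n)
        f (take i s ++ g (take m (drop i s)) :: drop (i + m) s).

Lemma take_mid s1 s2 (x : B) k : (size s1 < k)%N ->
  take k (s1 ++ x :: s2) = s1 ++ x :: take (k - size s1).-1 s2.
Proof.
move=> lt_s1k; rewrite take_cat ltnNge (ltnW lt_s1k) /=.
by case: (k - size s1)%N (subn_gt0 (size s1) k) => [|j] //=; rewrite lt_s1k.
Qed.

Lemma drop_mid s1 s2 (x : B) k : (size s1 < k)%N ->
  drop k (s1 ++ x :: s2) = drop (k - size s1).-1 s2.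
Proof.
move=> lt_s1k; rewrite drop_cat ltnNge (ltnW lt_s1k) /=.
by case: (k - size s1)%N (subn_gt0 (size s1) k) => [|j] //=; rewrite lt_s1k.
Qed.

Lemma dropl_cat s1 s2 k : (k <= size s1)%N ->
  drop k (s1 ++ s2) = drop k s1 ++ s2.
Proof.
rewrite drop_cat leq_eqVlt => /orP[/eqP->|->] //.
by rewrite ltnn subnn drop0 drop_size.
Qed.

Lemma mult_mul_subproof f g : mult_mul_fun f g \in @multilinear_pred K B.
Proof.
apply/asboolP => s1 s2 a u v; rewrite /mult_mul_fun !size_cat /=.
rewrite scaler_sumr -big_split; apply: eq_bigr => k _ /=.
have [le_ks1|lt_s1k] := leqP k (size s1).
  by rewrite !takel_cat // !dropl_cat // multP mulrDr scalerAr.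
by rewrite !take_mid // !drop_mid // multP mulrDl scalerAl.
Qed.

Lemma mult_I_subproof : mult_I_fun \in @multilinear_pred K B.
Proof.
apply/asboolP => -[|y [|z s1]] [|w s2] a u v //=; by rewrite scaler0 addr0.
Qed.

Lemma mult_ins_subproof f g : mult_ins_fun f g \in @multilinear_pred K B.
Proof.
apply/asboolP => s1 s2 a u v; rewrite /mult_ins_fun !size_cat /=.
rewrite scaler_sumr -big_split; apply: eq_bigr => n _ /=.
rewrite scaler_sumr -big_split; apply: eq_bigr => m _ /=.
rewrite scaler_sumr -big_split; apply: eq_bigr => i _ /=.
have [le_is1|lt_s1i] := leqP i (size s1); last first.
  rewrite !take_mid // !drop_mid // ?ltn_addr //.
  by rewrite -!catA !cat_cons multP.
rewrite !takel_cat // !(dropl_cat _ le_is1).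
have [le_ims1|lt_s1im] := leqP (i + m) (size s1).
  rewrite !takel_cat ?size_drop ?leq_subRL // !dropl_cat //.
  by rewrite -!cat_cons !catA multP.
rewrite !(drop_mid _ _ lt_s1im) !take_mid ?size_drop ?ltn_subLR //.
by rewrite multP multP.
Qed.

Definition mult_mul f g : mult B := Mult (mult_mul_subproof f g).
Definition mult_I : mult B := Mult mult_I_subproof.
Definition mult_ins f g : mult B := Mult (mult_ins_subproof f g).

End Operations.

Section Ginv.
Variables (K : fieldType) (B : algType K).

Definition ginv_pred : {pred mult B} := fun f => f [::] == 0.

Lemma ginv_submod_closed : submod_closed ginv_pred.
Proof.
split=> [|a f g /eqP f0 /eqP g0]; apply/eqP => //.
transitivity (a *: f [::] + g [::]) => //.
by rewrite f0 g0 scaler0 addr0.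
Qed.

HB.instance Definition _ := GRing.isSubmodClosed.Build K (mult B)
  ginv_pred (GRing.submod_closed_semi ginv_submod_closed).

Record ginv := Ginv {
  ginv_mult :> mult B;
  ginv_multP : ginv_mult \in ginv_pred }.

HB.instance Definition _ := [isSub for ginv_mult].
HB.instance Definition _ := [Choice of ginv by <:].
HB.instance Definition _ := [SubChoice_isSubLmodule of ginv by <:].

Implicit Types f g : ginv.

Lemma ginv_mul_subproof f g : mult_mul f g \in ginv_pred.
Proof.
apply/eqP; rewrite /= /mult_mul_fun big_ord_recl big_ord0 addr0 /=.
by rewrite (eqP (ginv_multP f)) mul0r.
Qed.

Lemma ginv_I_subproof : mult_I B \in ginv_pred.
Proof. exact/eqP. Qed.

Lemma ginv_ins_subproof f g : mult_ins f g \in ginv_pred.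
Proof. by apply/eqP; rewrite /= /mult_ins_fun big_geq. Qed.

Definition ginv_mul f g : ginv := Ginv (ginv_mul_subproof f g).
Definition ginv_I : ginv := Ginv ginv_I_subproof.
Definition ginv_ins f g : ginv := Ginv (ginv_ins_subproof f g).

Definition ginv_lie f g : ginv := ginv_mul f g - ginv_mul g f.

End Ginv.
Arguments ginv {K} B.
Arguments ginv_I {K} B.

(* Main.v *)
Require Import Defs.
From mathcomp Require Import all_boot all_order all_algebra.
From mathcomp Require Import all_classical.
From mathcomp Require Import zify.
Import GRing.Theory.
Local Open Scope ring_scope.

Set Implicit Arguments.
Unset Strict Implicit.
Unset Printing Implicit Defensive.

(** The insertion [ginv_ins g f], that is {g, f}, has two properties which
    together imply the theorem.

    - For fixed f, the map g |-> {g, f} is a derivation of the product (lemma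
      [ginv_insMl]): in (g . h)(u ++ f(v) :: w) the block f(v) is an argument
      of g or an argument of h.

    - {-, -} is a right pre-Lie product (lemma [ginv_ins_pre_lie]).  In
      {{x, y}, z} the block of z is either nested in the block of y, which
      gives {x, {y, z}}, or disjoint from it; the sum over the disjoint
      positions is symmetric in y and z.

    Now let R be a linear endomorphism and put f |> g := {g, R f}.  By the
    derivation property, f |> - is a derivation of the commutator.  By the
    pre-Lie identity, the commutator of x |> - and y |> - is insertion of
    {R y, R x} - {R x, R y}, so that the second post-Lie axiom only asks that

      R [x, y] = ({R y, R x} - R {y, R x}) - ({R x, R y} - R {x, R y}).

    The differences in parentheses measure how far R is from commuting with an
    insertion.  When R multiplies by I, the derivation property and {I, h} = h
    evaluate them:

    - for R f = I f, {R y, R x} - R {y, R x} = (I x) y, and the condition reads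
      I [x, y] = I x y - I y x;
    - for R f = - f I, it is y x I, and the condition reads
      - [x, y] I = y x I - x y I;
    - for R f = [I, f], it is [[I, x], y], and the condition is the Jacobi
      identity for I, x, y.

    All the sums involved range over the ways of cutting a sequence into
    consecutive blocks, possibly empty ones: an empty block contributes nothing
    to {g, f}, because f vanishes on the empty sequence and g is multilinear.
    With empty blocks allowed, cutting into several blocks is an iterated
    cutting into two, and the identities above reduce to the associativity
    lemma [split_sumA] and to the lemma [split_sum_mid], which cuts a sequence
    having a marked entry. *)

(** * Sums over the decompositions of a sequence *)

Section SplitSum.
Variables (T : Type) (V : nmodType).
Implicit Types s t u v w : seq T.

Definition split_sum s (F : seq T -> seq T -> V) : V :=
  \sum_(k < (size s).+1) F (take k s) (drop k s).

Lemma eq_split_sum s (F G : seq T -> seq T -> V) :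
  F =2 G -> split_sum s F = split_sum s G.
Proof. by move=> eqFG; apply: eq_bigr => k _; apply: eqFG. Qed.

Lemma split_sum_nil (F : seq T -> seq T -> V) :
  split_sum [::] F = F [::] [::].
Proof. by rewrite /split_sum big_ord1. Qed.

Lemma split_sum_cons x s (F : seq T -> seq T -> V) :
  split_sum (x :: s) F =
    F [::] (x :: s) + split_sum s (fun u v => F (x :: u) v).
Proof. by rewrite /split_sum big_ord_recl. Qed.

Lemma split_sumD s (F G : seq T -> seq T -> V) :
  split_sum s (fun u v => F u v + G u v) = split_sum s F + split_sum s G.
Proof. exact: big_split. Qed.

Lemma exchange_split_sum s t (F : seq T -> seq T -> seq T -> seq T -> V) :
  split_sum s (fun a b => split_sum t (fun c d => F a b c d)) =
  split_sum t (fun c d => split_sum s (fun a b => F a b c d)).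
Proof. exact: exchange_big. Qed.

(** Both sides sum over the decompositions of [s] into three blocks. *)
Lemma split_sumA s (F : seq T -> seq T -> seq T -> V) :
  split_sum s (fun u c => split_sum u (fun a b => F a b c)) =
  split_sum s (fun a t => split_sum t (fun b c => F a b c)).
Proof.
elim: s F => [|x s IHs] F; first by rewrite !split_sum_nil.
rewrite !split_sum_cons split_sum_nil -addrA; congr (_ + _).
rewrite -(IHs (fun a b c => F (x :: a) b c)) -split_sumD.
by apply: eq_split_sum => u c; rewrite split_sum_cons.
Qed.

(** Both sides sum over the decompositions of [s] into four blocks; the sum on
    the left cuts [s] in the middle, and then cuts both halves. *)
Lemma split_sumA4 s (F : seq T -> seq T -> seq T -> seq T -> V) :
  split_sum s (fun u t => split_sum t (fun c d =>
    split_sum u (fun a b => F a b c d))) =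
  split_sum s (fun a t => split_sum t (fun b t' =>
    split_sum t' (fun c d => F a b c d))).
Proof.
rewrite -(split_sumA s (fun a b t' => split_sum t' (fun c d => F a b c d))).
by apply: eq_split_sum => u t; rewrite exchange_split_sum.
Qed.

(** The cut falls either before or after the marked entry [e]. *)
Lemma split_sum_mid u e w (F : seq T -> seq T -> V) :
  split_sum (u ++ e :: w) F =
    split_sum u (fun a b => F a (b ++ e :: w))
    + split_sum w (fun a b => F (u ++ e :: a) b).
Proof.
elim: u F => [|x u IHu] F /=; first by rewrite split_sum_cons split_sum_nil.
by rewrite !split_sum_cons IHu addrA.
Qed.

(** The marked entry [e] lies in the third, the second or the first block. *)
Lemma split_sum3_mid u e w (F : seq T -> seq T -> seq T -> V) :
  split_sum (u ++ e :: w) (fun a t => split_sum t (fun b c => F a b c)) =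
    split_sum u (fun a t => split_sum t (fun b c => F a b (c ++ e :: w)))
    + split_sum u (fun a b => split_sum w (fun c d => F a (b ++ e :: c) d))
    + split_sum w (fun a t => split_sum t (fun b c => F (u ++ e :: a) b c)).
Proof.
rewrite split_sum_mid -split_sumD; congr (_ + _).
by apply: eq_split_sum => a b; rewrite split_sum_mid.
Qed.

End SplitSum.

(** * The product and the insertion of multilinear series *)

Section MultSeries.
Variables (K : fieldType) (B : algType K).
Implicit Types (f g h : ginv B) (s : seq B).

Lemma ginv_ext f g : (forall s, f s = g s) -> f = g.
Proof. by move=> eqfg; do 2! apply: val_inj; apply/funext. Qed.

Lemma ginv_mulE f g s : ginv_mul f g s = split_sum s (fun u v => f u * g v).
Proof. by []. Qed.

Lemma ginv_linE a f g s : (a *: f + g) s = a *: f s + g s.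
Proof. by []. Qed.

Lemma mult_slot0 f u w : f (u ++ 0 :: w) = 0.
Proof.
by have := multP f u w (-1) 0 0; rewrite scaler0 addr0 scaleN1r addNr.
Qed.

Lemma mult_slot_sum f u w (T : Type) (r : seq T) (P : pred T) (F : T -> B) :
  f (u ++ (\sum_(i <- r | P i) F i) :: w) =
  \sum_(i <- r | P i) f (u ++ F i :: w).
Proof.
apply: (big_morph (fun x => f (u ++ x :: w))); last exact: mult_slot0.
by move=> x y; have := multP f u w 1 x y; rewrite !scale1r.
Qed.

Lemma mult_slot_split_sum f u w s (F : seq B -> seq B -> B) :
  f (u ++ split_sum s F :: w) = split_sum s (fun a b => f (u ++ F a b :: w)).
Proof. exact: mult_slot_sum. Qed.

(** The arity n of the outer map is determined by that of the inner one, so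
    the insertion is a sum over the position i and the length m of the inner
    block; the terms with m = 0 are zero. *)
Lemma ginv_insE f g s :
  ginv_ins f g s =
    split_sum s (fun u t => split_sum t (fun v w => f (u ++ g v :: w))).
Proof.
pose G i m := f (take i s ++ g (take m (drop i s)) :: drop m (drop i s)).
set N := size s.
have G0 i : G i 0 = 0.
  by rewrite /G take0 (eqP (ginv_multP g)) mult_slot0.
transitivity (\sum_(0 <= m < N.+1) \sum_(0 <= i < N.+1 | (i + m <= N)%N) G i m).
  rewrite [ginv_ins f g s]/= /mult_ins_fun -/N.
  rewrite (exchange_big_dep_nat xpredT) //= [RHS]big_nat_recl //.
  rewrite [X in X + _]big1 ?add0r; last by move=> i _; apply: G0.
  rewrite big_add1; apply: eq_big_nat => m /= lt_mN.
  rewrite (eq_bigl (pred1 (N - m)%N)); last by move=> n /=; apply/eqP/eqP; lia.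
  rewrite big_nat1_eq ifT; last by lia.
  rewrite -(big_mkord xpredT (fun i =>
    f (take i s ++ g (take m.+1 (drop i s)) :: drop (i + m.+1) s))).
  rewrite (big_nat_widen _ _ N.+1) ?ltnS ?leq_subr //=; last by lia.
  rewrite big_nat_cond [RHS]big_nat_cond; apply: eq_big => i; first by lia.
  by move=> _; rewrite /G drop_drop [(m.+1 + i)%N]addnC.
rewrite (exchange_big_dep_nat xpredT) //= big_mkord.
apply: eq_bigr => i _; rewrite /split_sum size_drop -/N.
rewrite -(big_mkord xpredT (G i)) [RHS](big_nat_widen _ _ N.+1) //=; last first.
  by rewrite ltnS leq_subr.
rewrite big_nat_cond [RHS]big_nat_cond.
by apply: eq_bigl => m; have := ltn_ord i; lia.
Qed.

Lemma ginv_mul_bilinear : bilinear_op (@ginv_mul K B).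
Proof.
split=> [f|g] a x y; apply: ginv_ext => s; rewrite ginv_linE !ginv_mulE;
    rewrite scaler_sumr -big_split; apply: eq_bigr => k _.
  by rewrite ginv_linE mulrDr scalerAr.
by rewrite ginv_linE mulrDl scalerAl.
Qed.

Lemma ginv_ins_bilinear : bilinear_op (@ginv_ins K B).
Proof.
split=> [f|g] a x y; apply: ginv_ext => s; rewrite ginv_linE !ginv_insE;
    rewrite scaler_sumr -big_split; apply: eq_bigr => i _;
    rewrite scaler_sumr -big_split; apply: eq_bigr => m _.
  by rewrite ginv_linE multP.
exact: ginv_linE.
Qed.

Lemma ginv_mulA : associative (@ginv_mul K B).
Proof.
move=> f g h; apply: ginv_ext => s; rewrite !ginv_mulE.
transitivity (split_sum s (fun a t => split_sum t (fun b c =>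
    f a * g b * h c))).
  apply: eq_split_sum => a t; rewrite ginv_mulE mulr_sumr.
  by apply: eq_bigr => k _; rewrite mulrA.
rewrite -split_sumA; apply: eq_split_sum => u c.
by rewrite ginv_mulE mulr_suml.
Qed.

(** The block inserted into f . g is an argument of f or an argument of g. *)
Lemma ginv_insMl f g h :
  ginv_ins (ginv_mul f g) h =
    ginv_mul (ginv_ins f h) g + ginv_mul f (ginv_ins g h).
Proof.
apply: ginv_ext => s; rewrite ginv_insE.
transitivity (ginv_mul (ginv_ins f h) g s + ginv_mul f (ginv_ins g h) s) => //.
have inf : ginv_mul (ginv_ins f h) g s = split_sum s (fun u t =>
    split_sum t (fun v w => split_sum w (fun c d =>
      f (u ++ h v :: c) * g d))).
  transitivity (split_sum s (fun p d => split_sum p (fun u q =>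
      split_sum q (fun v c => f (u ++ h v :: c) * g d)))).
    rewrite ginv_mulE; apply: eq_split_sum => p d.
    rewrite ginv_insE mulr_suml; apply: eq_bigr => k _.
    by rewrite mulr_suml.
  by rewrite split_sumA; apply: eq_split_sum => u t; rewrite split_sumA.
have ing : ginv_mul f (ginv_ins g h) s = split_sum s (fun u t =>
    split_sum t (fun v w => split_sum u (fun a b =>
      f a * g (b ++ h v :: w)))).
  rewrite split_sumA4 ginv_mulE; apply: eq_split_sum => a t.
  rewrite ginv_insE mulr_sumr; apply: eq_bigr => k _.
  by rewrite mulr_sumr.
rewrite inf ing addrC -split_sumD; apply: eq_split_sum => u t.
rewrite -split_sumD; apply: eq_split_sum => v w.
by rewrite ginv_mulE split_sum_mid.
Qed.

(** The part of {{x, y}, z} where the blocks of y and z are disjoint, and the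
    block of y comes first. *)
Definition ins_disjoint x y z s : B :=
  split_sum s (fun a t => split_sum t (fun b t' =>
    split_sum t' (fun c t'' => split_sum t'' (fun d e =>
      x (a ++ y b :: c ++ z d :: e))))).

(** The block of z is an argument of x after the block of y, an argument
    of y, or an argument of x before the block of y. *)
Lemma ginv_ins_ins (x y z : ginv B) s :
  ginv_ins (ginv_ins x y) z s =
    ins_disjoint x y z s + ginv_ins x (ginv_ins y z) s + ins_disjoint x z y s.
Proof.
have after : ins_disjoint x y z s = split_sum s (fun u t =>
    split_sum t (fun v w => split_sum u (fun a u' =>
      split_sum u' (fun b c => x (a ++ y b :: c ++ z v :: w))))).
  rewrite split_sumA4; apply: eq_split_sum => a t.
  by rewrite split_sumA4.
have inside : ginv_ins x (ginv_ins y z) s = split_sum s (fun u t =>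
    split_sum t (fun v w => split_sum u (fun a b =>
      split_sum w (fun c d => x (a ++ y (b ++ z v :: c) :: d))))).
  rewrite split_sumA4 ginv_insE; apply: eq_split_sum => a t.
  transitivity (split_sum t (fun q d => split_sum q (fun b r =>
      split_sum r (fun v c => x (a ++ y (b ++ z v :: c) :: d))))).
    apply: eq_split_sum => q d; rewrite ginv_insE mult_slot_split_sum.
    by apply: eq_split_sum => b r; rewrite mult_slot_split_sum.
  by rewrite split_sumA; apply: eq_split_sum => b r; rewrite split_sumA.
have before : ins_disjoint x z y s = split_sum s (fun u t =>
    split_sum t (fun v w => split_sum w (fun a w' =>
      split_sum w' (fun b c => x ((u ++ z v :: a) ++ y b :: c))))).
  apply: eq_split_sum => u t; apply: eq_split_sum => v w.
  apply: eq_split_sum => a w'; apply: eq_split_sum => b c.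
  by rewrite -catA.
rewrite after inside before ginv_insE -!split_sumD.
apply: eq_split_sum => u t; rewrite -!split_sumD.
by apply: eq_split_sum => v w; rewrite ginv_insE split_sum3_mid.
Qed.

(** By [ginv_ins_ins], the associator is the sum over disjoint blocks, in
    either order. *)
Lemma ginv_ins_pre_lie (x y z : ginv B) :
  ginv_ins (ginv_ins x y) z - ginv_ins x (ginv_ins y z) =
  ginv_ins (ginv_ins x z) y - ginv_ins x (ginv_ins z y).
Proof.
apply: ginv_ext => s.
transitivity (ginv_ins (ginv_ins x y) z s - ginv_ins x (ginv_ins y z) s) => //.
transitivity (ginv_ins (ginv_ins x z) y s - ginv_ins x (ginv_ins z y) s) => //.
rewrite !ginv_ins_ins addrAC addrK [RHS]addrAC addrK.
exact: addrC.
Qed.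

(** Only blocks filling the whole sequence contribute, since I vanishes on the
    sequences of size other than 1. *)
Lemma ginv_insIl h : ginv_ins (ginv_I B) h = h.
Proof.
apply: ginv_ext => s; rewrite ginv_insE /split_sum big_ord_recl.
rewrite [X in _ + X]big1 ?addr0 => [|i _]; last first.
  rewrite big1 // => m _; case: s i m => [|x s] [] //= i _ m.
  by case: (take i s).
rewrite take0 drop0 big_ord_recr take_size drop_size /= big1 ?add0r // => m _.
move: (size_drop m s); case: (drop m s) => //= /esym/eqP.
by rewrite subn_eq0 leqNgt ltn_ord.
Qed.

End MultSeries.

(** * Post-Lie products from derivations given by a pre-Lie product *)

Section LinearOp.
Variables (K : fieldType) (V : lmodType K) (f : V -> V).
Hypothesis f_lin : linear f.

Lemma linear_fB x y : f (x - y) = f x - f y.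
Proof. by have := f_lin (-1) y x; rewrite !scaleN1r ![- _ + _]addrC. Qed.

Lemma linear_fN x : f (- x) = - f x.
Proof.
have f0 : f 0 = 0 by have := linear_fB 0 0; rewrite !subrr.
by rewrite -sub0r linear_fB f0 sub0r.
Qed.

End LinearOp.

Lemma subrACA (V : zmodType) (x y z t : V) :
  (x - y) - (z - t) = (x - z) - (y - t).
Proof. by rewrite [in LHS]opprD addrACA -opprD. Qed.

Section PreLieDerivation.
Variables (K : fieldType) (V : lmodType K) (mul ins : V -> V -> V).
Hypotheses (mul_bilin : bilinear_op mul) (ins_bilin : bilinear_op ins).
Hypothesis mulA : associative mul.
Hypothesis insMl : forall x y z,
  ins (mul x y) z = mul (ins x z) y + mul x (ins y z).
Hypothesis ins_pre_lie : forall x y z,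
  ins (ins x y) z - ins x (ins y z) = ins (ins x z) y - ins x (ins z y).
Implicit Types x y z : V.

Definition commutator x y := mul x y - mul y x.

Lemma commutatorC x y : commutator x y = - commutator y x.
Proof. by rewrite /commutator opprB. Qed.

Lemma commutator_bilinear : bilinear_op commutator.
Proof.
have [mulr mull] := mul_bilin.
by split=> z a x y;
  rewrite /commutator mulr (mull z a x y) scalerBr opprD addrACA.
Qed.

Lemma derivation_commutator (D : V -> V) :
    linear D -> (forall x y, D (mul x y) = mul (D x) y + mul x (D y)) ->
  forall x y,
    D (commutator x y) = commutator (D x) y + commutator x (D y).
Proof.
move=> D_lin DM x y; rewrite /commutator (linear_fB D_lin) !DM.
by rewrite [mul (D y) x + _]addrC opprD addrACA.
Qed.

(** Associativity makes [commutator z] a derivation of [mul]. *)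
Lemma commutator_commutator z x y :
  commutator z (commutator x y) =
    commutator (commutator z x) y + commutator x (commutator z y).
Proof.
have [mulr mull] := mul_bilin.
apply: derivation_commutator => [|{}x {}y].
  by case: commutator_bilinear.
rewrite /commutator (linear_fB (mulr x)) (linear_fB (mull y)) !mulA.
by rewrite addrA subrK.
Qed.

Lemma commutator_lie : lie_bracket commutator.
Proof.
have [com_r _] := commutator_bilinear.
split=> [|x|x y z]; [exact: commutator_bilinear | exact: subrr |].
rewrite commutator_commutator (commutatorC z x) (commutatorC z).
by rewrite (linear_fN (com_r y)) addrK subrr.
Qed.

(** The hypothesis on R is the second post-Lie axiom stripped of its argument:
    by the pre-Lie identity, the commutator of [ins^~ b] and [ins^~ a] is
    insertion of [ins a b - ins b a]. *)
Lemma post_lie_product_of_pre_lie (R : V -> V) :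
    linear R ->
    (forall x y, R (commutator x y) =
       (ins (R y) (R x) - R (ins y (R x)))
       - (ins (R x) (R y) - R (ins x (R y)))) ->
  post_lie_product commutator (fun f g => ins g (R f)).
Proof.
move=> R_lin RC; have [ins_r ins_l] := ins_bilin.
split.
- exact: commutator_lie.
- split=> [f|g] a x y; first exact: ins_l.
  by rewrite R_lin ins_r.
- move=> x y z; apply: (derivation_commutator (D := ins^~ (R z))) => //.
- move=> x y z; rewrite /assoc_of RC !(linear_fB (ins_r z)) subrACA.
  rewrite [RHS]subrACA; congr (_ - _); apply/esym/subr0_eq.
  by rewrite subrACA ins_pre_lie subrr.
Qed.

(** * Multiplication by a left unit of the insertion *)

Variable I : V.
Hypothesis insIl : forall x, ins I x = x.

Lemma post_lie_product_mull :
  post_lie_product commutator (fun f g => ins g (mul I f)).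
Proof.
have [mulr mull] := mul_bilin.
apply: post_lie_product_of_pre_lie => [|x y]; first exact: mulr.
by rewrite !insMl !insIl !addrK (linear_fB (mulr I)) !mulA.
Qed.

Lemma post_lie_product_mulr :
  post_lie_product commutator (fun f g => ins g (- mul f I)).
Proof.
have [mulr mull] := mul_bilin; have [_ ins_l] := ins_bilin.
apply: post_lie_product_of_pre_lie => [a x y|x y].
  by rewrite (mull I a x y) opprD scalerN.
have insR u v : ins (- mul v I) u - - mul (ins v u) I = - mul v u.
  by rewrite (linear_fN (ins_l u)) insMl insIl opprK opprD addrAC addNr add0r.
rewrite !insR !(linear_fN (mulr _)) !mulA !opprK.
by rewrite (linear_fB (mull I)) opprB addrC.
Qed.

Lemma post_lie_product_commutator :
  post_lie_product commutator (fun f g => ins g (commutator I f)).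
Proof.
have [com_r _] := commutator_bilinear; have [_ ins_l] := ins_bilin.
apply: post_lie_product_of_pre_lie => [|x y]; first exact: com_r.
have insC u v :
    ins (commutator I v) u - commutator I (ins v u) = commutator u v.
  by rewrite (derivation_commutator (D := ins^~ u)) // insIl addrK.
rewrite !insC commutator_commutator [commutator x _]commutatorC //.
Qed.

End PreLieDerivation.

Theorem proposition4p13 (K : fieldType) (charK : [pchar K] =i pred0)
    (B : algType K) :
  let I := ginv_I B in
  [/\ post_lie_product (@ginv_lie K B) (fun f g => ginv_ins g (ginv_mul I f)),
      post_lie_product (@ginv_lie K B) (fun f g => ginv_ins g (- ginv_mul f I)),
      forall f g : ginv B,
        ginv_ins g (- ginv_mul f I) = - ginv_ins g (ginv_mul f I)
    & post_lie_product (@ginv_lie K B) (fun f g => ginv_ins g (ginv_lie I f))].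
Proof.
have mul_bilin := @ginv_mul_bilinear K B.
have ins_bilin := @ginv_ins_bilinear K B.
have mulA := @ginv_mulA K B.
have insM := @ginv_insMl K B.
have ins_pl := @ginv_ins_pre_lie K B.
have insI := @ginv_insIl K B.
split.
- exact: post_lie_product_mull mul_bilin ins_bilin mulA insM ins_pl _ insI.
- exact: post_lie_product_mulr mul_bilin ins_bilin mulA insM ins_pl _ insI.
- by move=> f g; have [ins_r _] := ins_bilin; rewrite (linear_fN (ins_r g)).
- exact:
    post_lie_product_commutator mul_bilin ins_bilin mulA insM ins_pl _ insI.
Qed.
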